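(* Let $s\in\mathbb{R}$, let $(x_1,x_2,x_3,x_4)$ be coordinates on $\mathbb{R}^4$, and let $\mathcal{M}:=(\mathbb{R}^4,g)$, where the non-zero components (up to symmetry) of the pseudo-Riemannian metric $g$ are $$g(\partial_{x_1},\partial_{x_3})=g(\partial_{x_2},\partial_{x_4})=1,\qquad g(\partial_{x_3},\partial_{x_4})=s(x_2^2-x_1^2)/2,$$ $$g(\partial_{x_3},\partial_{x_3})=s\,x_1x_2,\qquad g(\partial_{x_4},\partial_{x_4})=-s\,x_1x_2.$$ Then $\mathcal{M}$ is locally symmetric (i.e. $\nabla R=0$), $\mathcal{M}$ is Jacobi--Videv, $\mathcal{M}$ is skew--Videv, and the Ricci operator satisfies $\rho^2=-s^2\operatorname{id}$.
   Context: For a pseudo-Riemannian manifold $(M,g)$ with Levi-Civita connection $\nabla$, let $\mathcal{R}(x,y)=\nabla_x\nabla_y-\nabla_y\nabla_x-\nabla_{[x,y]}$ be the curvature operator, $R(x,y,z,w)=g(\mathcal{R}(x,y)z,w)$ the curvature tensor, and $\mathcal{J}(x):y\mapsto\mathcal{R}(y,x)x$ the Jacobi operator. The polarized Jacobi operator is $\mathcal{J}(x_1,x_2):y\mapsto\frac12\{\mathcal{R}(y,x_1)x_2+\mathcal{R}(y,x_2)x_1\}$. The Ricci form is $\rho(x_1,x_2)=\operatorname{Tr}\{\mathcal{J}(x_1,x_2)\}$, and the Ricci operator $\rho$ is the endomorphism with $g(\rho x_1,x_2)=\rho(x_1,x_2)$. The manifold is Jacobi--Videv if $\mathcal{J}(x)\rho=\rho\mathcal{J}(x)$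 for all tangent vectors $x$, and skew--Videv if $\mathcal{R}(x,y)\rho=\rho\mathcal{R}(x,y)$ for all tangent vectors $x,y$ at the same point. *)

(* Defs.v *)
From HB Require Import structures.
From mathcomp Require Import all_boot all_order all_algebra.
From mathcomp Require Import all_classical all_reals topology normedtype derive.
From mathcomp Require Import ring.

Set Implicit Arguments.
Unset Strict Implicit.
Unset Printing Implicit Defensive.

Import Order.TTheory GRing.Theory Num.Theory.
Import numFieldNormedType.Exports.

Local Open Scope ring_scope.

(** Pseudo-Riemannian geometry on R^n in its standard global chart.  The
    tangent space at every point is identified with R^n; tangent vectors are
    row vectors, vector fields are functions from R^n to R^n, and a metric
    is given by its matrix in the coordinate frame. *)

Section Geometry.
Context {R : realType} {n : nat}.

Implicit Types (f : 'rV[R]_n -> R) (X Y Z : 'rV[R]_n -> 'rV[R]_n).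
Implicit Types (g : 'rV[R]_n -> 'M[R]_n) (p x y z w v : 'rV[R]_n).

Fixpoint Ck (k : nat) f : Prop :=
  if k is k'.+1 then
    (forall p, differentiable f p) /\ (forall v, Ck k' (fun p => 'D_v f p))
  else continuous f.

Definition smooth f : Prop := forall k, Ck k f.

Definition smooth_vf X : Prop := forall i, smooth (fun p => X p 0 i).

Definition dir X f : 'rV[R]_n -> R := fun p => 'D_(X p) f p.

Definition bracket X Y : 'rV[R]_n -> 'rV[R]_n := fun p =>
  \row_k (dir X (fun q => Y q 0 k) p - dir Y (fun q => X q 0 k) p).

Definition inner g p x y : R := (x *m g p *m y^T) 0 0.

Definition pseudo_riemannian g : Prop :=
  [/\ forall i j, smooth (fun p => g p i j),
      forall p, (g p)^T = g p
    & forall p, g p \in unitmx].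

(** A connection is an operation on smooth vector fields; its values on
    other functions are irrelevant. *)
Definition connection
    (nabla : ('rV[R]_n -> 'rV[R]_n) -> ('rV[R]_n -> 'rV[R]_n) ->
             'rV[R]_n -> 'rV[R]_n) : Prop :=
  [/\ forall X Y, smooth_vf X -> smooth_vf Y -> smooth_vf (nabla X Y),
      forall X X' Y p, smooth_vf X -> smooth_vf X' -> smooth_vf Y ->
        nabla (fun q => X q + X' q) Y p = nabla X Y p + nabla X' Y p,
      forall f X Y p, smooth f -> smooth_vf X -> smooth_vf Y ->
        nabla (fun q => f q *: X q) Y p = f p *: nabla X Y p,
      forall X Y Y' p, smooth_vf X -> smooth_vf Y -> smooth_vf Y' ->
        nabla X (fun q => Y q + Y' q) p = nabla X Y p + nabla X Y' p
    & forall f X Y p, smooth f -> smooth_vf X -> smooth_vf Y ->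
        nabla X (fun q => f q *: Y q) p = dir X f p *: Y p + f p *: nabla X Y p].

Definition torsion_free nabla : Prop :=
  forall X Y p, smooth_vf X -> smooth_vf Y ->
    nabla X Y p - nabla Y X p = bracket X Y p.

Definition metric_compatible g nabla : Prop :=
  forall X Y Z p, smooth_vf X -> smooth_vf Y -> smooth_vf Z ->
    dir X (fun q => inner g q (Y q) (Z q)) p =
    inner g p (nabla X Y p) (Z p) + inner g p (Y p) (nabla X Z p).

Definition levi_civita g nabla : Prop :=
  [/\ connection nabla, torsion_free nabla & metric_compatible g nabla].

Implicit Type nabla : ('rV[R]_n -> 'rV[R]_n) -> ('rV[R]_n -> 'rV[R]_n) ->
  'rV[R]_n -> 'rV[R]_n.

Definition curvature_vf nabla X Y Z : 'rV[R]_n -> 'rV[R]_n := fun p =>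
  nabla X (nabla Y Z) p - nabla Y (nabla X Z) p - nabla (bracket X Y) Z p.

(** The curvature is tensorial, so its value on tangent vectors at [p] is
    computed by extending them to any vector fields; we take the extensions
    with constant coefficients.  The same applies to [nabla_curvature]. *)
Definition curvature nabla p x y z : 'rV[R]_n :=
  curvature_vf nabla (cst x) (cst y) (cst z) p.

Definition curvature_tensor g nabla p x y z w : R :=
  inner g p (curvature nabla p x y z) w.

(** [(nabla_v R)(x, y, z, w)] at [p]. *)
Definition nabla_curvature g nabla p v x y z w : R :=
  'D_v (fun q => curvature_tensor g nabla q x y z w) p
  - curvature_tensor g nabla p (nabla (cst v) (cst x) p) y z w
  - curvature_tensor g nabla p x (nabla (cst v) (cst y) p) z w
  - curvature_tensor g nabla p x y (nabla (cst v) (cst z) p) w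
  - curvature_tensor g nabla p x y z (nabla (cst v) (cst w) p).

Definition locally_symmetric g nabla : Prop :=
  forall p v x y z w, nabla_curvature g nabla p v x y z w = 0.

Definition jacobi nabla p x y : 'rV[R]_n := curvature nabla p y x x.

Definition polarized_jacobi nabla p x1 x2 y : 'rV[R]_n :=
  2^-1 *: (curvature nabla p y x1 x2 + curvature nabla p y x2 x1).

Definition ricci_form nabla p x1 x2 : R :=
  \tr (lin1_mx (polarized_jacobi nabla p x1 x2)).

Definition is_ricci_operator g nabla
    (rho : 'rV[R]_n -> {linear 'rV[R]_n -> 'rV[R]_n}) : Prop :=
  forall p x1 x2, inner g p (rho p x1) x2 = ricci_form nabla p x1 x2.

Definition jacobi_videv nabla
    (rho : 'rV[R]_n -> {linear 'rV[R]_n -> 'rV[R]_n}) : Prop :=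
  forall p x y, jacobi nabla p x (rho p y) = rho p (jacobi nabla p x y).

Definition skew_videv nabla
    (rho : 'rV[R]_n -> {linear 'rV[R]_n -> 'rV[R]_n}) : Prop :=
  forall p x y z,
    curvature nabla p x y (rho p z) = rho p (curvature nabla p x y z).

End Geometry.

(** Coordinates are indexed from 0: [x_1], ..., [x_4] are [p 0 0], ..., [p 0 3]. *)
Definition metric4 {R : realType} (s : R) (p : 'rV[R]_4) : 'M[R]_4 :=
  let x1 := p 0 0 in let x2 := p 0 1 in
  \matrix_(i < 4, j < 4)
    match nat_of_ord i, nat_of_ord j with
    | 0%N, 2%N | 2%N, 0%N | 1%N, 3%N | 3%N, 1%N => 1
    | 2%N, 3%N | 3%N, 2%N => s * (x2 ^+ 2 - x1 ^+ 2) / 2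
    | 2%N, 2%N => s * x1 * x2
    | 3%N, 3%N => - (s * x1 * x2)
    | _, _ => 0
    end.

(** The hypotheses on [nabla] and [rho] used with [metric4] are satisfiable:
    [metric4_pseudo_riemannian], [levi_civita_exists] and
    [ricci_operator_exists] below. *)

Section SmoothTheory.
Context {R : realType} {n : nat}.
Implicit Types (f h : 'rV[R]_n -> R) (p v : 'rV[R]_n) (k : nat).

Lemma eq_Ck k f h : f =1 h -> Ck k h -> Ck k f.
Proof. by move=> /funext ->. Qed.

Lemma eq_smooth f h : f =1 h -> smooth h -> smooth f.
Proof. by move=> /funext ->. Qed.

Lemma CkW k f : Ck k.+1 f -> Ck k f.
Proof.
elim: k f => [|k IH] f [df Df]; last by split=> // v; exact/IH/Df.
by move=> p; apply: differentiable_continuous; exact: df.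
Qed.

Lemma smooth_diff f p : smooth f -> differentiable f p.
Proof. by move=> /(_ 1%N) []. Qed.

Lemma smooth_derivable f p v : smooth f -> derivable f p v.
Proof. by move=> sf; exact/diff_derivable/smooth_diff. Qed.

Lemma smooth_derive f v : smooth f -> smooth (fun p => 'D_v f p).
Proof. by move=> sf k; case: (sf k.+1) => _ /(_ v). Qed.

Lemma Ck_cst k (c : R) : Ck k (fun _ : 'rV[R]_n => c).
Proof.
elim: k c => [|k IH] c /=; first exact: cst_continuous.
split=> [p|v]; first exact: differentiable_cst.
by apply: eq_Ck (IH 0) => p; rewrite derive_cst.
Qed.

Lemma Ck_add k f h : Ck k f -> Ck k h -> Ck k (fun p => f p + h p).
Proof.
elim: k f h => [|k IH] f h /=; first by move=> cf ch p; exact: (continuousD (cf p) (ch p)).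
move=> [df Df] [dh Dh]; split=> [p|v]; first exact: differentiableD.
apply: (@eq_Ck _ _ (fun p => 'D_v f p + 'D_v h p)); last exact: IH.
by move=> p; rewrite deriveD//; exact: diff_derivable.
Qed.

Lemma Ck_mul k f h : Ck k f -> Ck k h -> Ck k (fun p => f p * h p).
Proof.
elim: k f h => [|k IH] f h; first by move=> cf ch p; exact: (continuousM (cf p) (ch p)).
move=> cf ch; have [df Df] := cf; have [dh Dh] := ch.
split=> [p|v]; first exact: differentiableM.
apply: (@eq_Ck _ _ (fun p => f p * 'D_v h p + h p * 'D_v f p)); last first.
  by apply: Ck_add; apply: IH; first [exact: CkW|exact: Df|exact: Dh].
by move=> p; rewrite deriveM//; exact: diff_derivable.
Qed.

Lemma Ck_inv k f : (forall p, f p != 0) -> Ck k f -> Ck k (fun p => (f p)^-1).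
Proof.
move=> f0; elim: k => [|k IH]; first by move=> cf p; exact: (continuousV (f0 p) (cf p)).
move=> cf; have [df Df] := cf.
split=> [p|v]; first exact: differentiableV.
apply: (@eq_Ck _ _ (fun p => (-1 * ((f p)^-1 * (f p)^-1)) * 'D_v f p)).
  move=> p; rewrite deriveV//; last exact: diff_derivable.
  by rewrite /GRing.scale /= mulN1r expr2 invfM.
apply: Ck_mul; last exact: Df.
apply: Ck_mul; first exact: Ck_cst.
by apply: Ck_mul; apply/IH/CkW.
Qed.

Lemma smooth_cst (c : R) : smooth (fun _ : 'rV[R]_n => c).
Proof. by move=> k; exact: Ck_cst. Qed.

Lemma smoothD f h : smooth f -> smooth h -> smooth (fun p => f p + h p).
Proof. by move=> sf sh k; exact: Ck_add. Qed.

Lemma smoothM f h : smooth f -> smooth h -> smooth (fun p => f p * h p).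
Proof. by move=> sf sh k; exact: Ck_mul. Qed.

Lemma smoothN f : smooth f -> smooth (fun p => - f p).
Proof.
move=> sf; apply: (@eq_smooth _ (fun p => -1 * f p)); first by move=> p; rewrite mulN1r.
by apply: smoothM => //; exact: smooth_cst.
Qed.

Lemma smoothV f : (forall p, f p != 0) -> smooth f -> smooth (fun p => (f p)^-1).
Proof. by move=> f0 sf k; exact: Ck_inv. Qed.

Lemma smooth_sum (I : Type) (r : seq I) (P : pred I) (F : I -> 'rV[R]_n -> R) :
  (forall i, P i -> smooth (F i)) -> smooth (fun p => \sum_(i <- r | P i) F i p).
Proof.
move=> sF; elim: r => [|i r IH].
  apply: (@eq_smooth _ (fun=> 0)); last exact: smooth_cst.
  by move=> p; rewrite big_nil.
apply: (@eq_smooth _ (fun p =>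
    (if P i then F i p else 0) + \sum_(j <- r | P j) F j p)).
  by move=> p; rewrite big_cons; case: ifP; rewrite ?add0r.
apply: smoothD => //; case: (P i) (sF i) => [/(_ isT) //|_].
exact: smooth_cst.
Qed.

Lemma smooth_prod (I : Type) (r : seq I) (P : pred I) (F : I -> 'rV[R]_n -> R) :
  (forall i, P i -> smooth (F i)) -> smooth (fun p => \prod_(i <- r | P i) F i p).
Proof.
move=> sF; elim: r => [|i r IH].
  apply: (@eq_smooth _ (fun=> 1)); last exact: smooth_cst.
  by move=> p; rewrite big_nil.
apply: (@eq_smooth _ (fun p =>
    (if P i then F i p else 1) * \prod_(j <- r | P j) F j p)).
  by move=> p; rewrite big_cons; case: ifP; rewrite ?mul1r.
apply: smoothM => //; case: (P i) (sF i) => [/(_ isT) //|_].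
exact: smooth_cst.
Qed.

Lemma smooth_det m (A : 'rV[R]_n -> 'M[R]_m) :
  (forall i j, smooth (fun p => A p i j)) -> smooth (fun p => \det (A p)).
Proof.
move=> sA; apply: smooth_sum => s _; apply: smoothM; first exact: smooth_cst.
by apply: smooth_prod => i _.
Qed.

Lemma smooth_invmx m (A : 'rV[R]_n -> 'M[R]_m) :
  (forall i j, smooth (fun p => A p i j)) -> (forall p, A p \in unitmx) ->
  forall i j, smooth (fun p => invmx (A p) i j).
Proof.
move=> sA uA i j.
apply: (@eq_smooth _ (fun p => (\det (A p))^-1 * cofactor (A p) j i)).
  by move=> p; rewrite /invmx uA !mxE.
apply: smoothM.
  apply: smoothV; last exact: smooth_det.
  by move=> p; rewrite -unitfE -unitmxE.
apply: smoothM; first exact: smooth_cst.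
apply: smooth_det => a b.
by apply: eq_smooth (sA (lift j a) (lift i b)) => p; rewrite !mxE.
Qed.

Lemma smooth_coord i : smooth (fun p : 'rV[R]_n => p 0 i).
Proof.
have D v p : 'D_v (fun q : 'rV[R]_n => q 0 i) p = v 0 i.
  have dq : differentiable (fun q : 'rV[R]_n => q) p by [].
  have := derive_mx (diff_derivable (v := v) dq).
  rewrite derive_id => /(congr1 (fun M : 'rV[R]_n => M 0 i)) ->.
  by rewrite mxE.
case=> [|k] /=; first by move=> p; exact: coord_continuous.
split=> [p|v]; first exact: differentiable_coord.
by apply: eq_Ck (Ck_cst k (v 0 i)) => p; rewrite D.
Qed.

Lemma dirE (X : 'rV[R]_n -> 'rV[R]_n) f p : smooth f ->
  dir X f p = \sum_i X p 0 i * 'D_(delta_mx 0 i) f p.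
Proof.
move=> /(@smooth_diff _ p) df; rewrite /dir deriveE// {1}(row_sum_delta (X p)).
rewrite linear_sum; apply: eq_bigr => i _.
by rewrite linearZ /= deriveE.
Qed.

Lemma smooth_dir (X : 'rV[R]_n -> 'rV[R]_n) f :
  smooth_vf X -> smooth f -> smooth (dir X f).
Proof.
move=> sX sf; apply: (@eq_smooth _ (fun p =>
    \sum_i X p 0 i * 'D_(delta_mx 0 i) f p)); first by move=> p; rewrite dirE.
by apply: smooth_sum => i _; apply: smoothM => //; exact: smooth_derive.
Qed.

End SmoothTheory.

Section LeviCivitaExists.
Context {R : realType} {n : nat}.
Implicit Types (X Y Z : 'rV[R]_n -> 'rV[R]_n) (f h : 'rV[R]_n -> R).
Context (g : 'rV[R]_n -> 'M[R]_n).
Context (gP : pseudo_riemannian g).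

Let gs i j : smooth (fun p => g p i j). Proof. by case: gP. Qed.
Let gC p i j : g p i j = g p j i.
Proof. by case: gP => _ /(_ p) gT _; rewrite -[in LHS]gT mxE. Qed.
Let gU p : g p \in unitmx. Proof. by case: gP. Qed.

Let dg k i j p : R := 'D_(delta_mx 0 k) (fun q => g q i j) p.

Let dgC k i j p : dg k i j p = dg k j i p.
Proof. by rewrite /dg; congr ('D__ _ _); apply/funext => q; exact: gC. Qed.

Let gam i j l p : R := 2^-1 * (dg i j l p + dg j i l p - dg l i j p).

Let gamP k i j p : gam k i j p + gam k j i p = dg k i j p.
Proof.
rewrite /gam (dgC k j i) (dgC i k j) (dgC j k i) (dgC j i k) (dgC i j k).
by field.
Qed.

Let gamC i j l p : gam i j l p = gam j i l p.
Proof. by rewrite /gam (dgC l i j) (addrC (dg i j l p)). Qed.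

Let corr X Y p : 'rV[R]_n :=
  \row_l \sum_i \sum_j gam i j l p * X p 0 i * Y p 0 j.

Let lc X Y p : 'rV[R]_n :=
  (\row_k dir X (fun q => Y q 0 k) p) + corr X Y p *m invmx (g p).

Let innerE p x y : inner g p x y = \sum_j (\sum_i x 0 i * g p i j) * y 0 j.
Proof.
by rewrite /inner mxE; apply: eq_bigr => j _; rewrite !mxE; congr (_ * _).
Qed.

Let innerC p x y : inner g p x y = inner g p y x.
Proof.
rewrite !innerE; under eq_bigr do rewrite mulr_suml.
rewrite exchange_big; apply: eq_bigr => i _; rewrite mulr_suml.
by apply: eq_bigr => j _; rewrite gC; ring.
Qed.

Lemma dirD X f h p : smooth f -> smooth h ->
  dir X (fun q => f q + h q) p = dir X f p + dir X h p.
Proof. by move=> sf sh; rewrite /dir deriveD //; exact: smooth_derivable. Qed.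

Lemma dirM X f h p : smooth f -> smooth h ->
  dir X (fun q => f q * h q) p = dir X f p * h p + f p * dir X h p.
Proof.
move=> sf sh; rewrite /dir deriveM; [|exact: smooth_derivable..].
by rewrite addrC /GRing.scale /= (mulrC (h p)).
Qed.

Lemma dir_sum X (I : Type) (r : seq I) (F : I -> 'rV[R]_n -> R) p :
  (forall i, smooth (F i)) ->
  dir X (fun q => \sum_(i <- r) F i q) p = \sum_(i <- r) dir X (F i) p.
Proof.
move=> sF; elim: r => [|i r IH].
  rewrite big_nil (_ : (fun q => _) = cst 0) /dir ?derive_cst//.
  by apply/funext => q; rewrite big_nil.
rewrite big_cons -IH -dirD//; last by apply: smooth_sum.
by congr dir; apply/funext => q; rewrite big_cons.
Qed.

Let lc_smooth X Y : smooth_vf X -> smooth_vf Y -> smooth_vf (lc X Y).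
Proof.
move=> sX sY k; apply: (@eq_smooth _ _ _ (fun p => dir X (fun q => Y q 0 k) p +
  \sum_l (\sum_i \sum_j gam i j l p * X p 0 i * Y p 0 j) * invmx (g p) l k)).
  by move=> p; rewrite !mxE; congr (_ + _); apply: eq_bigr => l _; rewrite mxE.
apply: smoothD; first exact: smooth_dir.
apply: smooth_sum => l _; apply: smoothM; last exact: smooth_invmx.
apply: smooth_sum => i _; apply: smooth_sum => j _.
apply: smoothM => //; apply: smoothM => //; apply: smoothM.
  exact: smooth_cst.
apply: smoothD; first by apply: smoothD; exact: smooth_derive.
by apply: smoothN; exact: smooth_derive.
Qed.

Lemma levi_civita_exists : exists nabla, levi_civita g nabla.
Proof.
exists lc; split; first split=> //.
- move=> X X' Y p _ _ sY; rewrite /lc.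
  rewrite (_ : corr _ Y p = corr X Y p + corr X' Y p).
    rewrite mulmxDl addrACA; congr (_ + _); apply/rowP => k; rewrite !mxE.
    rewrite !dirE// -big_split; apply: eq_bigr => i _.
    by rewrite mxE mulrDl.
  apply/rowP => l; rewrite !mxE -big_split; apply: eq_bigr => i _.
  by rewrite -big_split; apply: eq_bigr => j _ /=; rewrite !mxE; ring.
- move=> f X Y p _ _ sY; rewrite /lc scalerDr scalemxAl; congr (_ + _); last congr (mulmx _ _).
    apply/rowP => k; rewrite !mxE !dirE// mulr_sumr; apply: eq_bigr => i _.
    by rewrite mxE mulrA.
  apply/rowP => l; rewrite !mxE mulr_sumr; apply: eq_bigr => i _.
  by rewrite mulr_sumr; apply: eq_bigr => j _; rewrite !mxE; ring.
- move=> X Y Y' p _ sY sY'; rewrite /lc.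
  rewrite (_ : corr X _ p = corr X Y p + corr X Y' p).
    rewrite mulmxDl addrACA; congr (_ + _); apply/rowP => k; rewrite !mxE.
    by rewrite -dirD//; congr dir; apply/funext => q; rewrite mxE.
  apply/rowP => l; rewrite !mxE -big_split; apply: eq_bigr => i _.
  by rewrite -big_split; apply: eq_bigr => j _ /=; rewrite !mxE; ring.
- move=> f X Y p sf _ sY; rewrite /lc scalerDr scalemxAl addrA.
  congr (_ + _); last congr (mulmx _ _).
    apply/rowP => k; rewrite !mxE -dirM//.
    by congr dir; apply/funext => q; rewrite mxE.
  apply/rowP => l; rewrite !mxE mulr_sumr; apply: eq_bigr => i _.
  by rewrite mulr_sumr; apply: eq_bigr => j _; rewrite !mxE; ring.
- move=> X Y p sX sY; rewrite /lc /bracket.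
  rewrite (_ : corr Y X p = corr X Y p).
    by rewrite opprD addrACA subrr addr0; apply/rowP => k; rewrite !mxE.
  apply/rowP => l; rewrite !mxE exchange_big; apply: eq_bigr => i _.
  by apply: eq_bigr => j _; rewrite gamC; ring.
- move=> X Y Z p sX sY sZ; rewrite (innerC p (Y p)).
  have E V W : inner g p (lc X V p) (W p) =
      \sum_j (\sum_i dir X (fun q => V q 0 i) p * g p i j) * W p 0 j +
      \sum_j (\sum_k \sum_i gam k i j p * X p 0 k * V p 0 i) * W p 0 j.
    rewrite /lc /inner mulmxDl mulmxDl -(mulmxA _ (invmx _)) mulVmx// mulmx1 mxE.
    congr (_ + _); rewrite mxE; apply: eq_bigr => j _; rewrite !mxE//.
    by congr (_ * _); apply: eq_bigr => i _; rewrite mxE.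
  rewrite !E (_ : (fun q => _) =
      fun q => \sum_j (\sum_i Y q 0 i * g q i j) * Z q 0 j); last first.
    by apply/funext => q; rewrite innerE.
  rewrite dir_sum => [|j]; last first.
    by apply: smoothM => //; apply: smooth_sum => i _; exact: smoothM.
  have D j : dir X (fun q => (\sum_i Y q 0 i * g q i j) * Z q 0 j) p =
      (\sum_i dir X (fun q => Y q 0 i) p * g p i j) * Z p 0 j +
      \sum_i Y p 0 i * (\sum_k X p 0 k * dg k i j p) * Z p 0 j +
      \sum_i dir X (fun q => Z q 0 j) p * g p j i * Y p 0 i.
    rewrite dirM//; last by apply: smooth_sum => i _; exact: smoothM.
    rewrite dir_sum => [|i]; last exact: smoothM.
    under eq_bigr => i _ do rewrite dirM// (dirE _ _ (gs i j)).
    rewrite big_split mulrDl; congr (_ + _ + _); first by rewrite mulr_suml.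
    by rewrite mulr_suml; apply: eq_bigr => i _; rewrite gC; ring.
  under eq_bigr => j _ do rewrite D.
  rewrite !big_split /= -!addrA; congr (_ + _); rewrite [RHS]addrCA addrC.
  congr (_ + _).
    rewrite exchange_big; apply: eq_bigr => i _; rewrite mulr_suml.
    by apply: eq_bigr => j _.
  have -> : \sum_j (\sum_k \sum_i gam k i j p * X p 0 k * Z p 0 i) * Y p 0 j =
      \sum_j (\sum_k \sum_i gam k j i p * X p 0 k * Y p 0 i) * Z p 0 j.
    under eq_bigr do rewrite mulr_suml.
    under [RHS]eq_bigr do rewrite mulr_suml.
    rewrite exchange_big [RHS]exchange_big; apply: eq_bigr => k _.
    under eq_bigr do rewrite mulr_suml.
    under [RHS]eq_bigr do rewrite mulr_suml.
    rewrite exchange_big; apply: eq_bigr => i _; apply: eq_bigr => j _.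
    by ring.
  rewrite -big_split; apply: eq_bigr => j _ /=; rewrite -mulrDl -mulr_suml.
  congr (_ * _); under [LHS]eq_bigr do rewrite mulr_sumr.
  rewrite exchange_big -big_split; apply: eq_bigr => k _ /=.
  rewrite -big_split; apply: eq_bigr => i _ /=.
  by rewrite -gamP; ring.
Qed.

End LeviCivitaExists.

Section RicciOperatorExists.
Context {R : realType} {n : nat}.
Implicit Types (X Y Z : 'rV[R]_n -> 'rV[R]_n).
Context (g : 'rV[R]_n -> 'M[R]_n).
Context (nabla : ('rV[R]_n -> 'rV[R]_n) -> ('rV[R]_n -> 'rV[R]_n) ->
  'rV[R]_n -> 'rV[R]_n).
Context (gP : pseudo_riemannian g).
Context (nablaP : connection nabla).

Let scst (x : 'rV[R]_n) : smooth_vf (cst x).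
Proof. by move=> i; exact: smooth_cst. Qed.

Let sadd X Y : smooth_vf X -> smooth_vf Y -> smooth_vf (fun q => X q + Y q).
Proof.
move=> sX sY i; apply: (@eq_smooth _ _ _ (fun q => X q 0 i + Y q 0 i)).
  by move=> q; rewrite mxE.
exact: smoothD.
Qed.

Let sscale (a : R) X : smooth_vf X -> smooth_vf (fun q => a *: X q).
Proof.
move=> sX i; apply: (@eq_smooth _ _ _ (fun q => a * X q 0 i)).
  by move=> q; rewrite mxE.
by apply: smoothM => //; exact: smooth_cst.
Qed.

Let snabla X Y : smooth_vf X -> smooth_vf Y -> smooth_vf (nabla X Y).
Proof. by case: nablaP => S _ _ _ _; exact: S. Qed.

Let nabla_linl a X X' Y : smooth_vf X -> smooth_vf X' -> smooth_vf Y ->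
  nabla (fun q => a *: X q + X' q) Y = fun p => a *: nabla X Y p + nabla X' Y p.
Proof.
move=> sX sX' sY; case: nablaP => _ D S _ _; apply/funext => p.
rewrite (D (fun q => a *: X q))//; last exact: sscale.
by rewrite (S (fun=> a))//; exact: smooth_cst.
Qed.

Let nabla_linr a X Y Y' : smooth_vf X -> smooth_vf Y -> smooth_vf Y' ->
  nabla X (fun q => a *: Y q + Y' q) = fun p => a *: nabla X Y p + nabla X Y' p.
Proof.
move=> sX sY sY'; case: nablaP => _ _ _ D S; apply/funext => p.
rewrite (D _ (fun q => a *: Y q))//; last exact: sscale.
rewrite (S (fun=> a))//; last exact: smooth_cst.
by rewrite /dir derive_cst scale0r add0r.
Qed.

Let curvatureE p x y z : curvature nabla p x y z =
  nabla (cst x) (nabla (cst y) (cst z)) p -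
  nabla (cst y) (nabla (cst x) (cst z)) p.
Proof.
rewrite /curvature /curvature_vf (_ : bracket _ _ = fun q => 0 *: cst 0 q).
  case: nablaP => _ _ S _ _; rewrite (S (fun=> 0))//; last exact: smooth_cst.
  by rewrite scale0r subr0.
apply/funext => q; apply/rowP => k; rewrite scale0r !mxE /dir.
by rewrite !derive_cst subr0.
Qed.

Let cstl a (x x' : 'rV[R]_n) :
  cst (a *: x + x') = fun q : 'rV[R]_n => a *: cst x q + cst x' q.
Proof. by []. Qed.

Let curvature_lin2 p x a y y' z : curvature nabla p x (a *: y + y') z =
  a *: curvature nabla p x y z + curvature nabla p x y' z.
Proof.
rewrite !curvatureE cstl !nabla_linl ?nabla_linr//; try exact: snabla.
by rewrite scalerBr opprD addrACA.
Qed.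

Let curvature_lin3 p x y a z z' : curvature nabla p x y (a *: z + z') =
  a *: curvature nabla p x y z + curvature nabla p x y z'.
Proof.
rewrite !curvatureE cstl !nabla_linr//; try exact: snabla.
by rewrite scalerBr opprD addrACA.
Qed.

Let ricciC p x y : ricci_form nabla p x y = ricci_form nabla p y x.
Proof.
by rewrite /ricci_form; congr (\tr (lin1_mx _)); apply/funext => z;
  rewrite /polarized_jacobi addrC.
Qed.

Let ricci_lin p a x x' y : ricci_form nabla p (a *: x + x') y =
  a * ricci_form nabla p x y + ricci_form nabla p x' y.
Proof.
have L (f : 'rV[R]_n -> 'rV[R]_n) i : lin1_mx f i i = f (delta_mx 0 i) 0 i.
  by rewrite mxE.
have D (u v : 'rV[R]_n) i : (a *: u + v) 0 i = a * u 0 i + v 0 i.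
  by rewrite !mxE.
rewrite /ricci_form /mxtrace mulr_sumr -big_split; apply: eq_bigr => i _ /=.
rewrite !L -D /polarized_jacobi curvature_lin2 curvature_lin3.
by rewrite addrACA -scalerDr (scalerDr 2^-1 (a *: _)) !scalerA (mulrC a).
Qed.

Lemma ricci_operator_exists : exists rho, is_ricci_operator g nabla rho.
Proof.
have [gs gT gU] := gP.
suff /choice[rho rhoP] : forall p, exists r : {linear 'rV[R]_n -> 'rV[R]_n},
    forall x1 x2, inner g p (r x1) x2 = ricci_form nabla p x1 x2.
  by exists rho.
move=> p.
pose r x := (\row_j ricci_form nabla p x (delta_mx 0 j)) *m invmx (g p).
have rL : linear r.
  move=> a x y; rewrite /r scalemxAl -mulmxDl; congr mulmx.
  by apply/rowP => j; rewrite !mxE ricci_lin.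
pose rB := GRing.isLinear.Build _ _ _ _ _ rL.
exists (HB.pack r rB : {linear _ -> _}) => x y.
rewrite /inner /= /r -(mulmxA _ (invmx _)) mulVmx// mulmx1 mxE.
have ricci0 : ricci_form nabla p 0 x = 0.
  have := ricci_lin p (-1) 0 0 x.
  by rewrite scaler0 addr0 mulN1r addNr.
rewrite ricciC {2}(row_sum_delta y).
have -> (s : seq 'I_n) :
    ricci_form nabla p (\sum_(j <- s) y 0 j *: delta_mx 0 j) x =
    \sum_(j <- s) y 0 j * ricci_form nabla p (delta_mx 0 j) x.
  elim: s => [|j s IH]; first by rewrite !big_nil.
  by rewrite !big_cons ricci_lin IH.
by apply: eq_bigr => j _; rewrite !mxE mulrC ricciC.
Qed.

End RicciOperatorExists.

Lemma metric4_pseudo_riemannian {R : realType} (s : R) :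
  pseudo_riemannian (metric4 s).
Proof.
have sX i : smooth (fun p : 'rV[R]_4 => p 0 i) by exact: smooth_coord.
split=> [i j|p|p].
- pose x1 (p : 'rV[R]_4) := p 0 0; pose x2 (p : 'rV[R]_4) := p 0 1.
  have s12 : smooth (fun p : 'rV[R]_4 => s * x1 p * x2 p).
    exact: smoothM (smoothM (smooth_cst s) (sX 0)) (sX 1).
  have sd : smooth (fun p : 'rV[R]_4 => s * (x2 p ^+ 2 - x1 p ^+ 2) / 2).
    apply: smoothM; last exact: smooth_cst.
    apply: smoothM; first exact: smooth_cst.
    exact: smoothD (smoothM (sX 1) (sX 1)) (smoothN (smoothM (sX 0) (sX 0))).
  have := smoothN s12; have := @smooth_cst R 4 0; have := @smooth_cst R 4 1.
  move=> s1 s0 sN; have E F : (forall p, metric4 s p i j = F p) -> smooth F ->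
      smooth (fun p => metric4 s p i j) by move=> e; apply: eq_smooth.
  case: i j E => [[|[|[|[|i]]]] ?] [[|[|[|[|j]]]] ?] // E;
    first [by apply: E s0 => p; rewrite mxE|by apply: E s1 => p; rewrite mxE|
      by apply: E s12 => p; rewrite mxE|by apply: E sN => p; rewrite mxE|
      by apply: E sd => p; rewrite mxE].
- apply/matrixP => i j; rewrite !mxE.
  by case: i j => [[|[|[|[|i]]]] ?] [[|[|[|[|j]]]] ?].
- pose a := s * p 0 0 * p 0 1; pose b := s * (p 0 1 ^+ 2 - p 0 0 ^+ 2) / 2.
  pose h : 'M[R]_4 := \matrix_(i < 4, j < 4)
    match nat_of_ord i, nat_of_ord j with
    | 0%N, 2%N | 2%N, 0%N | 1%N, 3%N | 3%N, 1%N => 1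
    | 0%N, 1%N | 1%N, 0%N => - b
    | 0%N, 0%N => - a
    | 1%N, 1%N => a
    | _, _ => 0
    end.
  suff /mulmx1_unit[] : metric4 s p *m h = 1%:M by [].
  apply/matrixP => i j; rewrite !mxE !big_ord_recr big_ord0 /= !mxE /= -/a -/b.
  case: i j => [[|[|[|[|i]]]] ?] [[|[|[|[|j]]]] ?] //=;
    rewrite ?mulr0 ?mul0r ?mul1r ?mulr1 ?add0r ?addr0 //; ring.
Qed.

(* Main.v *)
Require Import Defs.
From mathcomp Require Import all_boot all_order all_algebra.
From mathcomp Require Import all_classical all_reals topology normedtype derive.
From mathcomp Require Import ring.
Import Order.TTheory GRing.Theory Num.Theory.
Import numFieldNormedType.Exports.
Local Open Scope ring_scope.

(** The metric is the real part of a holomorphic one.  Put z = x1 + i x2 and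
    u = x3 - i x4; then g = Re h for the complex bilinear metric

      h = 2 dz du + a z^2 du^2,   a = - i s / 2,

    on C^2.  A holomorphic metric 2 dz du + f(z) du^2 has constant Gaussian
    curvature f''/2 when f is quadratic, here K = a.  Hence, with J the
    multiplication by i,

      R(x, y) z = K (h(y, z) x - h(x, z) y),
      h(x, y) = g(x, y) - i g(J x, y),

    and everything follows from this formula.  Since h and J are parallel and
    K is constant, R is parallel.  Taking real traces, the Ricci operator is
    multiplication by the complex number 2 K = - i s, that is rho = - s J, so
    that rho^2 = - s^2.  Since R is complex linear in each argument, R(x, y)
    and the Jacobi operators commute with rho.

    The proof is carried out over the reals.  For constant vector fields the
    Koszul formula gives g(nabla_x y, z) as a form linear in the base point
    (the non-constant coefficients of the metric are quadratic forms), and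
    compatibility with the metric gives

      g(R(x, y) z, w) = x g(nabla_y z, w) - g(nabla_y z, nabla_x w)
                        - y g(nabla_x z, w) + g(nabla_x z, nabla_y w)

    ([inner_curvature]).  Only derivatives of the metric and of these linear
    forms ([derive_inner4], [derive_koszul4]) are needed, never those of the
    cubic Christoffel symbols.  [curvature4] then is the polynomial identity
    [inner_curv4]; [curv4_trace] computes the Ricci tensor, and
    [locally_symmetric4] differentiates the curvature formula by the Leibniz
    rule. *)

Set Implicit Arguments.
Unset Strict Implicit.
Unset Printing Implicit Defensive.

(** * The Levi-Civita connection on constant vector fields *)

Section LeviCivitaOfConstantFields.
Context {R : realType} {n : nat}.
Context (g : 'rV[R]_n -> 'M[R]_n).
Context (nabla : ('rV[R]_n -> 'rV[R]_n) -> ('rV[R]_n -> 'rV[R]_n) ->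
  'rV[R]_n -> 'rV[R]_n).
Context (gP : pseudo_riemannian g).
Implicit Types (p v x y z w : 'rV[R]_n).

Lemma innerDl p x y z : inner g p (x + y) z = inner g p x z + inner g p y z.
Proof. by rewrite /inner !mulmxDl mxE. Qed.

Lemma innerZl p a x y : inner g p (a *: x) y = a * inner g p x y.
Proof. by rewrite /inner -!scalemxAl mxE. Qed.

Lemma innerNl p x y : inner g p (- x) y = - inner g p x y.
Proof. by rewrite -scaleN1r innerZl mulN1r. Qed.

(** Used to compute traces: the left-hand side is the trace of the rank one map
    [v |-> g(v, y) x]. *)
Lemma sum_inner_delta p x y :
  \sum_i inner g p (delta_mx 0 i) y * x 0 i = inner g p x y.
Proof.
rewrite [in RHS](row_sum_delta x) /inner !mulmx_suml summxE.
by apply: eq_bigr => i _; rewrite -!scalemxAl [RHS]mxE mulrC.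
Qed.

Lemma innerC p x y : inner g p x y = inner g p y x.
Proof.
have [_ gT _] := gP.
by rewrite /inner -[in RHS](gT p) -[in RHS](trmxK y) -!trmx_mul [RHS]mxE mulmxA.
Qed.

Lemma inner_inj p x y : (forall z, inner g p x z = inner g p y z) -> x = y.
Proof.
have [_ _ gU] := gP => exy.
rewrite -[x](mulmxK (gU p)) -[y](mulmxK (gU p)); congr (_ *m _).
apply/rowP => j; have := exy (delta_mx 0 j).
by rewrite /inner trmx_delta -!colE !mxE.
Qed.

Lemma smooth_inner (X : 'rV[R]_n -> 'rV[R]_n) y :
  smooth_vf X -> smooth (fun q => inner g q (X q) y).
Proof.
have [gs _ _] := gP => sX.
apply: (@eq_smooth _ _ _
    (fun q => \sum_j (\sum_i X q 0 i * g q i j) * y 0 j)).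
  by move=> q; rewrite /inner mxE; apply: eq_bigr => j _; rewrite !mxE.
apply: smooth_sum => j _; apply: smoothM; last exact: smooth_cst.
by apply: smooth_sum => i _; exact: smoothM.
Qed.

Lemma smooth_vf_cst x : smooth_vf (cst x : 'rV[R]_n -> 'rV[R]_n).
Proof. by move=> i; exact: smooth_cst. Qed.

Lemma bracket_cst x y : bracket (cst x) (cst y) = cst (0 : 'rV[R]_n).
Proof.
apply/funext => p; apply/rowP => k.
by rewrite !mxE /dir !derive_cst subrr.
Qed.

Context (nablaP : levi_civita g nabla).

Lemma nabla_cstC p x y : nabla (cst x) (cst y) p = nabla (cst y) (cst x) p.
Proof.
have [_ tf _] := nablaP; apply/eqP; rewrite -subr_eq0.
by rewrite tf ?bracket_cst//; exact: smooth_vf_cst.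
Qed.

Lemma derive_inner_cst p v x y : 'D_v (fun q => inner g q x y) p =
  inner g p (nabla (cst v) (cst x) p) y + inner g p x (nabla (cst v) (cst y) p).
Proof.
by have [_ _ /(_ (cst v) (cst x) (cst y) p)] := nablaP; apply;
  exact: smooth_vf_cst.
Qed.

(** The brackets of constant fields vanish, which leaves only the derivatives of
    the metric coefficients in the Koszul formula. *)
Lemma koszul_cst p x y z :
  inner g p (nabla (cst x) (cst y) p) z =
  2^-1 * ('D_x (fun q => inner g q y z) p + 'D_y (fun q => inner g q x z) p
          - 'D_z (fun q => inner g q x y) p).
Proof.
rewrite !derive_inner_cst (nabla_cstC p y x) (nabla_cstC p z x) (nabla_cstC p z y).
by rewrite (innerC p x) (innerC p (nabla (cst x) (cst z) p)); field.
Qed.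

(** Compatibility with the metric trades the second covariant derivatives for
    derivatives of the functions [g(nabla_y z, w)], which the Koszul formula makes
    explicit. *)
Lemma inner_curvature p x y z w :
  inner g p (curvature nabla p x y z) w =
  ('D_x (fun q => inner g q (nabla (cst y) (cst z) q) w) p
   - inner g p (nabla (cst y) (cst z) p) (nabla (cst x) (cst w) p))
  - ('D_y (fun q => inner g q (nabla (cst x) (cst z) q) w) p
   - inner g p (nabla (cst x) (cst z) p) (nabla (cst y) (cst w) p)).
Proof.
have [[sN _ linl _ _] _ mc] := nablaP; have sc := smooth_vf_cst.
have D a b : 'D_a (fun q => inner g q (nabla (cst b) (cst z) q) w) p =
    inner g p (nabla (cst a) (nabla (cst b) (cst z)) p) w +
    inner g p (nabla (cst b) (cst z) p) (nabla (cst a) (cst w) p).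
  exact: (mc (cst a) _ (cst w) p (sc a) (sN _ _ (sc b) (sc z)) (sc w)).
rewrite !D !addrK /curvature /curvature_vf bracket_cst.
(* The connection vanishes on the zero field by linearity over the functions. *)
rewrite (_ : cst 0 = fun q : 'rV[R]_n => 0 *: cst 0 q); last first.
  by apply/funext => q; rewrite scaler0.
rewrite (linl (fun=> 0))//; last exact: smooth_cst.
by rewrite scale0r subr0 innerDl innerNl.
Qed.

End LeviCivitaOfConstantFields.

(** * Coordinates on R^4 *)

(* [0] and [1] in ['I_4] are used as such, to agree syntactically with the
   entries [p 0 0] and [p 0 1] in the metric. *)
Local Notation i2 := (@Ordinal 4 2 isT).
Local Notation i3 := (@Ordinal 4 3 isT).

Definition row4 {R : Type} (a b c d : R) : 'rV[R]_4 :=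
  \row_i nth a [:: a; b; c; d] i.

Lemma sum4E {V : nmodType} (F : 'I_4 -> V) :
  \sum_i F i = F 0 + F 1 + F i2 + F i3.
Proof.
by rewrite !big_ord_recr big_ord0 /= add0r; congr (_ + _ + _ + _); congr F;
  exact: val_inj.
Qed.

Lemma row4P {T : Type} (x y : 'rV[T]_4) :
  x 0 0 = y 0 0 -> x 0 1 = y 0 1 -> x 0 i2 = y 0 i2 -> x 0 i3 = y 0 i3 -> x = y.
Proof.
move=> e0 e1 e2 e3; apply/rowP => -[[|[|[|[|//]]]] lti].
- by rewrite (_ : Ordinal _ = 0)//; exact: val_inj.
- by rewrite (_ : Ordinal _ = 1)//; exact: val_inj.
- by rewrite (_ : Ordinal _ = i2)//; exact: val_inj.
- by rewrite (_ : Ordinal _ = i3)//; exact: val_inj.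
Qed.

(** The scalar products and the entries of vectors are replaced by variables first:
    comparing them as atoms up to conversion would unfold the ordinals. *)
Ltac ring_coord :=
  repeat match goal with
    |- context [inner ?g ?p ?x ?y] => move: (inner g p x y) => ?
  end;
  repeat match goal with
    |- context [fun_of_matrix ?x ?i ?j] => move: (fun_of_matrix x i j) => ?
  end;
  by first [ring | field].

(** * Connection and curvature of the metric *)

Section Metric4.
Context {R : realType} (s : R).
Implicit Types p v x y z w : 'rV[R]_4.
Local Notation g := (metric4 s).

Lemma inner4E p x y : inner g p x y =
  x 0 0 * y 0 i2 + x 0 1 * y 0 i3 + x 0 i2 * y 0 0 + x 0 i3 * y 0 1
  + s * p 0 0 * p 0 1 * (x 0 i2 * y 0 i2 - x 0 i3 * y 0 i3)
  + s * (p 0 1 ^+ 2 - p 0 0 ^+ 2) / 2 * (x 0 i2 * y 0 i3 + x 0 i3 * y 0 i2).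
Proof. rewrite /inner mxE !sum4E !mxE !sum4E !mxE /=; ring_coord. Qed.

#[local] Instance is_derive_coord p v (i : 'I_4) :
  is_derive p v (fun q : 'rV[R]_4 => q 0 i) (v 0 i).
Proof.
have dq : differentiable (fun q : 'rV[R]_4 => q) p by [].
have := derive_mx (diff_derivable (v := v) dq).
rewrite derive_id => /(congr1 (fun M : 'rV[R]_4 => M 0 i)); rewrite mxE => ->.
exact/derivableP/diff_derivable/differentiable_coord.
Qed.

(** The derivative of [metric4] at [p] in the direction [v]. *)
Definition dmetric4 p v x y : R :=
  s * (v 0 0 * p 0 1 + p 0 0 * v 0 1) * (x 0 i2 * y 0 i2 - x 0 i3 * y 0 i3)
  + s * (p 0 1 * v 0 1 - p 0 0 * v 0 0) * (x 0 i2 * y 0 i3 + x 0 i3 * y 0 i2).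

Lemma derive_inner4 p v x y :
  'D_v (fun q => inner g q x y) p = dmetric4 p v x y.
Proof.
pose X i := fun q : 'rV[R]_4 => q 0 i.
(* A combination of coordinate functions by operations on functions, the form
   that the derivation rules recognize. *)
rewrite (_ : (fun q => _) =
  cst (x 0 0 * y 0 i2 + x 0 1 * y 0 i3 + x 0 i2 * y 0 0 + x 0 i3 * y 0 1)
  + (s * (x 0 i2 * y 0 i2 - x 0 i3 * y 0 i3)) \*: (X 0 * X 1)
  + (s / 2 * (x 0 i2 * y 0 i3 + x 0 i3 * y 0 i2)) \*: (X 1 ^+ 2 - X 0 ^+ 2)).
  rewrite derive_val /dmetric4 /X /GRing.scale /=; ring_coord.
apply/funext => q; rewrite inner4E /X !fctE /= /GRing.scale /=; ring_coord.
Qed.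

(** The right-hand side of the Koszul formula, a Christoffel symbol of the first
    kind; it is linear in the base point [p] because the non-constant part of the
    metric is homogeneous of degree two. *)
Definition koszul4 p v x y : R :=
  2^-1 * (dmetric4 p v x y + dmetric4 p x v y - dmetric4 p y v x).

(** A linear form is its own derivative, hence the base point [v] on the right. *)
Lemma derive_koszul4 p v x y z :
  'D_v (fun q => koszul4 q x y z) p = koszul4 v x y z.
Proof.
pose X i := fun q : 'rV[R]_4 => q 0 i.
(* Only the first two coordinates of the base point occur in [koszul4]. *)
pose e0 : 'rV[R]_4 := row4 1 0 0 0; pose e1 : 'rV[R]_4 := row4 0 1 0 0.
rewrite (_ : (fun q => _) =
  koszul4 e0 x y z \*: X 0 + koszul4 e1 x y z \*: X 1).
  rewrite derive_val /koszul4 /dmetric4 /e0 /e1 !mxE /GRing.scale /=; ring_coord.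
apply/funext => q.
transitivity (koszul4 e0 x y z * q 0 0 + koszul4 e1 x y z * q 0 1) => //.
rewrite /koszul4 /dmetric4 /e0 /e1 !mxE /=; ring_coord.
Qed.

(** The Christoffel symbols of [h = 2 dz du + a z^2 du^2].  Solving the complex
    Koszul equations gives, with [A = x_z y_u + x_u y_z] and [B = x_u y_u],

      (nabla_x y)_z = a z A + a^2 z^3 B   and   (nabla_x y)_u = - a z B,

    where [z = z1 + i z2] is the first complex coordinate of [p], [a = - i s / 2],
    [x_z = x1 + i x2] and [x_u = x3 - i x4]; below, [Z = z^3].  The last entry is
    the opposite of an imaginary part, since [u = x3 - i x4]. *)
Definition gamma4 p x y : 'rV[R]_4 :=
  let Are := x 0 0 * y 0 i2 + x 0 1 * y 0 i3 + y 0 0 * x 0 i2 + y 0 1 * x 0 i3 in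
  let Aim := x 0 1 * y 0 i2 - x 0 0 * y 0 i3 + y 0 1 * x 0 i2 - y 0 0 * x 0 i3 in
  let Bre := x 0 i2 * y 0 i2 - x 0 i3 * y 0 i3 in
  let Bim := - (x 0 i2 * y 0 i3 + x 0 i3 * y 0 i2) in
  let z1 := p 0 0 in let z2 := p 0 1 in
  let Zre := z1 ^+ 3 - 3 * z1 * z2 ^+ 2 in
  let Zim := 3 * z1 ^+ 2 * z2 - z2 ^+ 3 in
  row4
    (s / 2 * (z2 * Are + z1 * Aim) - s ^+ 2 / 4 * (Zre * Bre - Zim * Bim))
    (s / 2 * (z2 * Aim - z1 * Are) - s ^+ 2 / 4 * (Zre * Bim + Zim * Bre))
    (- (s / 2) * (z2 * Bre + z1 * Bim))
    (s / 2 * (z2 * Bim - z1 * Bre)).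

Lemma inner_gamma4 p x y z : inner g p (gamma4 p x y) z = koszul4 p x y z.
Proof. rewrite inner4E !mxE /koszul4 /dmetric4 /=; ring_coord. Qed.

(** Multiplication by [i] in the complex coordinates [x1 + i x2], [x3 - i x4]. *)
Definition J4 x : 'rV[R]_4 := row4 (- x 0 1) (x 0 0) (x 0 i3) (- x 0 i2).

(** [g] is the real part of a complex bilinear form, and [Re (i h)] may be read
    on either argument. *)
Lemma inner_J4 p x y : inner g p (J4 x) y = inner g p x (J4 y).
Proof. rewrite !inner4E !mxE /=; ring_coord. Qed.

Lemma J4K x : J4 (J4 x) = - x.
Proof. by apply: row4P; rewrite !mxE /= ?opprK. Qed.

Lemma J4D x y : J4 (x + y) = J4 x + J4 y.
Proof. by apply: row4P; rewrite !mxE /= ?opprD. Qed.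

Lemma J4N x : J4 (- x) = - J4 x.
Proof. by apply: row4P; rewrite !mxE. Qed.

Lemma J4Z a x : J4 (a *: x) = a *: J4 x.
Proof. by apply: row4P; rewrite !mxE /= ?mulrN. Qed.

(** The Christoffel symbols are complex bilinear, so [J] is parallel. *)
Lemma gamma4_J p x y : gamma4 p x (J4 y) = J4 (gamma4 p x y).
Proof. apply: row4P; rewrite !mxE /=; ring_coord. Qed.

(** [K (h(y, z) x - h(x, z) y)] with [K = - i s / 2] and
    [h(x, y) = g(x, y) - i g(J x, y)]: indeed [i h(y, z) x] is
    [g(y, z) J x + g(J y, z) x]. *)
Definition curv4 p x y z : 'rV[R]_4 := - (s / 2) *:
  (inner g p y z *: J4 x + inner g p (J4 y) z *: x
   - (inner g p x z *: J4 y + inner g p (J4 x) z *: y)).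

Lemma inner_curv4 p x y z w : inner g p (curv4 p x y z) w =
  (koszul4 x y z w - inner g p (gamma4 p y z) (gamma4 p x w))
  - (koszul4 y x z w - inner g p (gamma4 p x z) (gamma4 p y w)).
Proof.
rewrite !(inner4E p (curv4 _ _ _ _)) !(inner4E p (gamma4 _ _ _)) !mxE /=.
rewrite !inner4E !mxE /koszul4 /dmetric4 /=; ring_coord.
Qed.

Lemma curv4_Jr p x y z : curv4 p x y (J4 z) = J4 (curv4 p x y z).
Proof.
rewrite /curv4 -!inner_J4 !J4K !(innerNl, J4Z, J4D, J4N, J4K).
by rewrite !(scaleNr, scalerN) ![_ + - (_ *: _)]addrC.
Qed.

Lemma curv4Zl p a x y z : curv4 p (a *: x) y z = a *: curv4 p x y z.
Proof.
rewrite /curv4 !J4Z !innerZl.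
by apply: row4P; rewrite !mxE /=; ring_coord.
Qed.

Lemma curv4Zr p a x y z : curv4 p x y (a *: z) = a *: curv4 p x y z.
Proof.
have innerZr u v : inner g p u (a *: v) = a * inner g p u v.
  by rewrite !inner4E !mxE; ring_coord.
rewrite /curv4 !innerZr.
by apply: row4P; rewrite !mxE /=; ring_coord.
Qed.

Lemma curv4_Jl p x y z : curv4 p (J4 x) y z = J4 (curv4 p x y z).
Proof.
rewrite /curv4 !J4K !(innerNl, J4Z, J4D, J4N, J4K).
by rewrite !(scaleNr, scalerN) ![_ + - (_ *: _)]addrC.
Qed.

Lemma inner_curv4E p x y z w : inner g p (curv4 p x y z) w =
  - (s / 2) * (inner g p y z * inner g p (J4 x) w
               + inner g p (J4 y) z * inner g p x w
               - (inner g p x z * inner g p (J4 y) w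
                  + inner g p (J4 x) z * inner g p y w)).
Proof. by rewrite /curv4 !(innerZl, innerDl, innerNl). Qed.

(** Up to the factor [- s / 2], the trace of [z |-> R(z, x) y] symmetrized in
    [x] and [y] is the sum of [tr J = 0] times [g(x, y)], [tr id = 4] times
    [g(J x, y)], and minus the traces of four halves of rank one maps, each equal
    to [g(J x, y) / 2]: the total is [2 g(J x, y)]. *)
Lemma curv4_trace p x y :
  \tr (lin1_mx (fun z => 2^-1 *: (curv4 p z x y + curv4 p z y x))) =
  - s * inner g p (J4 x) y.
Proof.
have gP := metric4_pseudo_riemannian s.
have trJ : \sum_i J4 (delta_mx 0 i) 0 i = 0.
  by rewrite sum4E !mxE /= !oppr0 !addr0.
have tr1 : \sum_i (delta_mx 0 i : 'rV[R]_4) 0 i = 4.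
  by under eq_bigr do rewrite mxE !eqxx; rewrite sumr_const card_ord.
transitivity (\sum_i - (s / 2) *
    ((inner g p x y * J4 (delta_mx 0 i) 0 i
      + inner g p (J4 x) y * (delta_mx 0 i : 'rV[R]_4) 0 i)
     - 2^-1 * (((inner g p (delta_mx 0 i) y * J4 x 0 i
                 + inner g p (delta_mx 0 i) (J4 y) * x 0 i)
                + inner g p (delta_mx 0 i) x * J4 y 0 i)
               + inner g p (delta_mx 0 i) (J4 x) * y 0 i))).
  rewrite /mxtrace; apply: eq_bigr => i _; rewrite mxE /curv4 -!inner_J4.
  rewrite (innerC gP p y x) (inner_J4 p y x) (innerC gP p y (J4 x)).
  move: (delta_mx 0 i) => e; move: (J4 e) (J4 x) (J4 y) => Je Jx Jy.
  rewrite !mxE; ring_coord.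
rewrite -mulr_sumr sumrB !big_split -!mulr_sumr !big_split /= !sum_inner_delta.
have JC : inner g p (J4 y) x = inner g p (J4 x) y.
  by rewrite (innerC gP p (J4 y)) inner_J4.
rewrite trJ tr1 -!inner_J4 JC; ring_coord.
Qed.

Context (nabla : ('rV[R]_4 -> 'rV[R]_4) -> ('rV[R]_4 -> 'rV[R]_4) ->
  'rV[R]_4 -> 'rV[R]_4).
Context (nablaP : levi_civita g nabla).

Lemma nabla_cst4 x y : nabla (cst x) (cst y) = fun p => gamma4 p x y.
Proof.
have gP := metric4_pseudo_riemannian s.
apply/funext => p; apply: (inner_inj (p := p) gP) => z.
by rewrite inner_gamma4 (koszul_cst gP nablaP) !derive_inner4.
Qed.

Lemma curvature4 p x y z : curvature nabla p x y z = curv4 p x y z.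
Proof.
have gP := metric4_pseudo_riemannian s.
apply: (inner_inj (p := p) gP) => w; rewrite (inner_curvature nablaP) inner_curv4.
rewrite !nabla_cst4.
by congr (_ - _ - (_ - _)); under eq_fun do rewrite inner_gamma4;
  exact: derive_koszul4.
Qed.

(** The curvature is a polynomial in the products [g(a, b)] and [g(J a, b)] of
    the four arguments.  The Leibniz rule for these products, with
    [nabla_v (J a) = J (nabla_v a)], yields exactly the correction terms of the
    covariant derivative. *)
Lemma locally_symmetric4 : locally_symmetric g nabla.
Proof.
move=> p v x y z w; rewrite /nabla_curvature /curvature_tensor.
pose G a b q := inner g q a b.
pose N a := nabla (cst v) (cst a) p.
have NJ a : N (J4 a) = J4 (N a) by rewrite /N !nabla_cst4 gamma4_J.
have dG a b : is_derive p v (G a b) (G (N a) b p + G a (N b) p).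
  rewrite -(derive_inner_cst nablaP); apply/derivableP/smooth_derivable.
  apply: smooth_inner; first exact: metric4_pseudo_riemannian.
  exact: smooth_vf_cst.
under eq_fun do rewrite curvature4 inner_curv4E.
rewrite !curvature4 !inner_curv4E -!/(N _).
rewrite (_ : (fun q => _) = - (s / 2) \*:
  (G y z * G (J4 x) w + G (J4 y) z * G x w
   - (G x z * G (J4 y) w + G (J4 x) z * G y w))); last first.
  by apply/funext.
rewrite derive_val !NJ /GRing.scale /= /G; ring_coord.
Qed.

Lemma ricci_operator4 (rho : 'rV[R]_4 -> {linear 'rV[R]_4 -> 'rV[R]_4}) p x :
  is_ricci_operator g nabla rho -> rho p x = - s *: J4 x.
Proof.
have gP := metric4_pseudo_riemannian s.
move=> rhoP; apply: (inner_inj (p := p) gP) => y; rewrite rhoP innerZl -curv4_trace.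
rewrite /ricci_form; congr (\tr (lin1_mx _)); apply/funext => z.
by rewrite /polarized_jacobi !curvature4.
Qed.

End Metric4.

Theorem theorem1p9 (R : realType) (s : R)
    (nabla : ('rV[R]_4 -> 'rV[R]_4) -> ('rV[R]_4 -> 'rV[R]_4) ->
             'rV[R]_4 -> 'rV[R]_4)
    (rho : 'rV[R]_4 -> {linear 'rV[R]_4 -> 'rV[R]_4}) :
  levi_civita (metric4 s) nabla ->
  is_ricci_operator (metric4 s) nabla rho ->
  [/\ locally_symmetric (metric4 s) nabla,
      jacobi_videv nabla rho,
      skew_videv nabla rho
    & forall p x, rho p (rho p x) = - s ^+ 2 *: x].
Proof.
move=> nablaP rhoP.
have rhoE p x : rho p x = - s *: J4 x by exact: (ricci_operator4 nablaP).
split.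
- exact: locally_symmetric4.
- move=> p x y; rewrite /jacobi !(curvature4 nablaP) !rhoE.
  by rewrite curv4Zl curv4_Jl.
- move=> p x y z; rewrite !(curvature4 nablaP) !rhoE.
  by rewrite curv4Zr curv4_Jr.
- by move=> p x; rewrite !rhoE J4Z J4K !scalerN scalerA mulrNN -scaleNr.
Qed.
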